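(* Consider the noiseless setting with $\mathcal H_{-\infty}(\mathbf X)<\infty$, and assume the Shannon entropy rate $\mathcal H_1(\mathbf X)$ exists. Assume there is $\eta>0$ such that the strong mixing coefficients satisfy $d(s;\mathbf X)\le s^{-(\beta\mathcal H_{-\infty}(\mathbf X)+\eta)}$ for all $s\in\mathbb N_+$. Then there is a sequence $\epsilon_n\to0$ such that for all $n$ \[ P^*_{\mathrm{error}}\ge 2(1+\epsilon_n)\left\{\beta\wedge\frac1{\mathcal H_1(\mathbf X)}\right\}\frac{\log n}{n}. \]
   Context: Setting. Let $\mathcal X$ be a finite alphabet; logarithms are to base $|\mathcal X|$. Let $\mathbf X=\{X_i\}_{i\in\mathbb Z}$ be a stationary random process on $\mathcal X$. Fix $\beta>0$; for $n\in\mathbb N$ let $\ell=\ell(n)=\beta\log n$ (rounded to an integer) and $n_\ell:=n-(2\ell-1)$. Let $I(1)\sim\mathrm{Uniform}[n]$ and, conditionally on $I(1)$, let $I(2)$ be uniform on $I(1)+\{-\ell+1,\dots,n-\ell\}$ if $1\le I(1)\le \ell-1$, uniform on $[n]$ if $\ell\le I(1)\le n-\ell+1$, and uniform on $I(1)+\{\ell-n,\dots,\ell-1\}$ if $n-\ell+2\le I(1)\le n$; $(I(1),I(2))$ is independent of $\mathbf X$. The noiseless reads are $X_1^\ell(j):=X_{I(j)}^{I(j)+\ell-1}$, $j=1,2$. The signed overlap is $T:=\max\{0,\ell-(I(2)-I(1))\}$ if $I(2)\ge I(1)$ and $T:=-\max\{0,\ell-(I(1)-I(2))\}$ if $I(2)<I(1)$;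 it takes values in $\mathcal T:=\{-(\ell-1),\dots,0,\dots,\ell\}$ with $\mathbb P[T=0]=n_\ell/n$ and $\mathbb P[T=t]=1/n$ for $t\ne0$. Noisy reads $Y_1^\ell(j)$ are obtained from a Markov kernel $P_{Y_1^\ell\mid X_1^\ell}$, conditionally independently given the noiseless reads. A detector is any map $\hat T:\mathcal Y^\ell\times\mathcal Y^\ell\to\mathcal T$; $P_{\mathrm{error}}(\hat T):=\mathbb P[\hat T(Y_1^\ell(1),Y_1^\ell(2))\ne T]$, $P^*_{\mathrm{error}}:=\min_{\hat T}P_{\mathrm{error}}(\hat T)$. Noiseless setting: $\mathbf X$ is stationary and ergodic and $Y_1^\ell=X_1^\ell$ with probability one. Rényi entropies: $H_\alpha(P)=\frac1{1-\alpha}\log\sum_xP^\alpha(x)$ ($\alpha\ne1$), $H_1(P)$ the Shannon entropy, $H_{-\infty}(P)=-\log\min_{x\in\mathrm{supp}(P)}P(x)$; rates $\mathcal H_\alpha(\mathbf X):=\lim_{t\to\infty}\frac1{2t+1}H_\alpha(P_{X_{-t}^t})$ (assumed to exist). Strong mixing coefficient: $d(s;\mathbf X):=\sup\{|\mathbb P[\mathcal F\mid\mathcal E]-\mathbb P[\mathcal F]|: i\in\mathbb Z,\ \mathcal E\in\sigma(X_{-\infty}^i),\ \mathcal F\in\sigma(X_{i+s}^\infty)\}$, taken non-increasing in $s$. *)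

(* Defs.v *)
From HB Require Import structures.
From mathcomp Require Import all_boot all_order all_algebra.
From mathcomp Require Import all_classical all_reals all_analysis.
Import Order.TTheory GRing.Theory Num.Theory.
Import numFieldNormedType.Exports.
Local Open Scope classical_set_scope.
Local Open Scope ring_scope.

(* Path space Z -> X of a process on the finite alphabet X (x0 : X is only
   used to make the type pointed, as required by measurableType). *)
Record path (X : finType) (x0 : X) := Path { path_fun :> int -> X }.
HB.instance Definition _ (X : finType) (x0 : X) := gen_eqMixin (path X x0).
HB.instance Definition _ (X : finType) (x0 : X) := gen_choiceMixin (path X x0).
HB.instance Definition _ (X : finType) (x0 : X) :=
  isPointed.Build (path X x0) (Path X x0 (fun _ => x0)).

Definition coord_events (X : finType) (x0 : X) (J : set int) : set (set (path X x0)) :=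
  [set A | exists j a, J j /\ A = [set w : path X x0 | w j = a]].

Definition cyl (X : finType) (x0 : X) := coord_events X x0 setT.
Definition Omega (X : finType) (x0 : X) := g_sigma_algebraType (cyl X x0).

Definition shift (X : finType) (x0 : X) (w : Omega X x0) : Omega X x0 :=
  Path X x0 (fun i => w (i + 1)%R).

Definition logX {R : realType} (X : finType) (x : R) : R := ln x / ln (#|X|%:R).

Section Process.
Context {R : realType} {X : finType} {x0 : X} (mu : probability (Omega X x0) R).

Definition Pr (A : set (Omega X x0)) : R := fine (mu A).

Definition stationary : Prop :=
  forall A : set (Omega X x0), measurable A -> mu (shift X x0 @^-1` A) = mu A.

Definition ergodic : Prop :=
  forall A : set (Omega X x0), measurable A -> shift X x0 @^-1` A = A ->
    mu A = 0%E \/ mu A = 1%E.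


Definition window_pmf (t : nat) (w : {ffun 'I_(2 * t).+1 -> X}) : R :=
  Pr [set om : Omega X x0 | forall j : 'I_(2 * t).+1, om (j%:Z - t%:Z) = w j].

Definition shannon (T : finType) (P : T -> R) : R :=
  \sum_(x | 0 < P x) - (P x * logX X (P x)).
(* min over the support; the idx 1 is harmless since pmf values are <= 1 *)
Definition H_minf (T : finType) (P : T -> R) : R :=
  - logX X (\big[Order.min/1]_(x | 0 < P x) P x).

Definition shannon_rate (h : R) : Prop :=
  (fun t : nat => shannon _ (window_pmf t) / (2 * t).+1%:R) @ \oo --> h.
Definition minf_rate (h : R) : Prop :=
  (fun t : nat => H_minf _ (window_pmf t) / (2 * t).+1%:R) @ \oo --> h.

Definition past (i : int) := coord_events X x0 [set j | j <= i].
Definition future (i : int) := coord_events X x0 [set j | i <= j].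
Definition mixing_coeff (s : nat) : R :=
  sup [set x : R | exists (i : int) (E F : set (Omega X x0)),
         <<s past i >> E /\ <<s future (i + s%:Z) >> F /\ 0 < Pr E /\
         x = `| Pr (F `&` E) / Pr E - Pr F |].

Definition readlen (beta : R) (n : nat) : nat := Num.truncn (beta * logX X n%:R + 2^-1).

Definition read (l : nat) (om : Omega X x0) (i : int) : {ffun 'I_l -> X} :=
  [ffun j : 'I_l => om (i + j%:Z)].

(* offset of the support of I(2) relative to I(1) *)
Definition lo (n l : nat) (i1 : int) : int :=
  if i1 <= l%:Z - 1 then - l%:Z + 1
  else if i1 <= n%:Z - l%:Z + 1 then - i1 + 1
  else l%:Z - n%:Z.

Definition overlap (l : nat) (i1 i2 : int) : int :=
  if i1 <= i2 then Num.max 0 (l%:Z - (i2 - i1))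
  else - Num.max 0 (l%:Z - (i1 - i2)).

(* element of cal T = {-(l-1),...,l} encoded by k : 'I_(2l) *)
Definition tval (l : nat) (k : 'I_(2 * l)) : int := k%:Z - (l%:Z - 1).

Definition detector (l : nat) := {ffun 'I_l -> X} -> {ffun 'I_l -> X} -> 'I_(2 * l).

(* P[ That(X(1), X(2)) <> T ] in the noiseless setting:
   I(1) uniform on [n], I(2) | I(1) uniform on I(1) + lo + {0..n-1} *)
Definition perror (n l : nat) (f : detector l) : R :=
  \sum_(a < n) \sum_(k < n)
    (n%:R ^+ 2)^-1 *
    (let i1 := a%:Z + 1 in let i2 := i1 + lo n l i1 + k%:Z in
     Pr [set om : Omega X x0 |
          tval l (f (read l om i1) (read l om i2)) <> overlap l i1 i2]).

Definition perror_opt (beta : R) (n : nat) : R :=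
  inf [set perror n (readlen beta n) f | f in [set: detector (readlen beta n)]].

End Process.

(* Main.v *)
Require Import Defs.
From HB Require Import structures.
From mathcomp Require Import all_boot all_order all_algebra.
From mathcomp Require Import all_classical all_reals all_analysis.
From mathcomp Require Import zify ring lra.
Import Order.TTheory GRing.Theory Num.Theory.
Import numFieldNormedType.Exports.
Local Open Scope classical_set_scope.
Local Open Scope ring_scope.

(** A detector either declares "no overlap" on most typical pairs of reads, and
    then misses the short overlaps, or it raises false alarms on independent reads.
    If two reads of length [l] overlap in [t] letters, the typical probability of
    the pair is about [exp (- (2 l - t) h)], against [exp (- 2 l h)] for independent
    reads. For [t <= (1 - delta) log n / h1] the likelihood ratio is thus at most
    [n ^ (1 - delta / 2)], too small to compensate the factor [1 / n] by which such
    an overlap is less likely a priori than no overlap; each of the values [t] and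
    [- t] therefore contributes [(1 - o(1)) / n] to the error.

    Strong mixing enters twice. At distance of order [n] it makes the law of two
    reads at least half of a product law, because its rate beats the least positive
    probability [n ^ (- beta h_minf)] of a read. It also gives the equipartition
    property: the probability of a long word is compared with the product of the
    probabilities of its blocks of a fixed length [k], whose logarithm obeys a
    second-moment weak law of large numbers with mean the block entropy. This bounds
    [- ln p] from above by about [l h]; as [- ln p / l] is bounded and has
    mean close to [h], the reverse bound follows. *)

(** * Finite observables of the process *)

Section Observables.
Context {R : realType} {X : finType} {x0 : X} (mu : probability (Omega X x0) R).

Lemma Pr_ge0 A : 0 <= Pr mu A.
Proof. exact: fine_ge0. Qed.

Lemma PrE A : measurable A -> (Pr mu A)%:E = mu A.
Proof. by move=> mA; rewrite fineK// fin_num_measure. Qed.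

Lemma Pr_le A B : measurable A -> measurable B -> A `<=` B -> Pr mu A <= Pr mu B.
Proof.
move=> mA mB AB; rewrite -lee_fin !PrE//.
by apply: le_measure; rewrite ?inE.
Qed.

Lemma Pr_setT : Pr mu setT = 1.
Proof. by rewrite /Pr probability_setT. Qed.

Lemma Pr_set0 : Pr mu set0 = 0.
Proof. by rewrite /Pr measure0. Qed.

Lemma Pr_le1 A : measurable A -> Pr mu A <= 1.
Proof. by move=> mA; rewrite -Pr_setT; apply: Pr_le. Qed.

Definition observable {T : finType} (Z : Omega X x0 -> T) :=
  forall z, measurable [set om | Z om = z].

Lemma observable_set {T : finType} {Z : Omega X x0 -> T} (Q : pred T) :
  observable Z -> measurable [set om | Q (Z om)].
Proof.
move=> mZ.
have -> : [set om | Q (Z om)] = \bigcup_(z in [set z | Q z]) [set om | Z om = z].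
  apply/seteqP; split => [om /= Qz|om [z Qz /= ->]//].
  by exists (Z om).
apply: fin_bigcup_measurable => //; exact: finite_finset.
Qed.

Lemma observable_pair {T U : finType} {Z : Omega X x0 -> T} {W : Omega X x0 -> U} :
  observable Z -> observable W -> observable (fun om => (Z om, W om)).
Proof.
move=> mZ mW [z w].
have -> : [set om | (Z om, W om) = (z, w)] = [set om | Z om = z] `&` [set om | W om = w].
  by apply/seteqP; split => om /= [-> ->].
exact: measurableI.
Qed.

Lemma Pr_sum {T : finType} {Z : Omega X x0 -> T} (Q : pred T) :
  observable Z ->
  Pr mu [set om | Q (Z om)] = \sum_(z | Q z) Pr mu [set om | Z om = z].
Proof.
move=> mZ; apply/EFin_inj; rewrite PrE; last exact: observable_set.
rewrite -sumEFin.
under eq_bigr do rewrite PrE//.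
have -> : [set om | Q (Z om)] = \bigcup_(z in [set` Q]) [set om | Z om = z].
  apply/seteqP; split => [om /= Qz|om [z Qz /= ->]//].
  by exists (Z om).
rewrite measure_fin_bigcup//; last first.
  by apply/trivIsetP => z w _ _ /eqP zw; rewrite -subset0 => om /= [-> /zw].
by rewrite -(@bigfs _ _ _ _ (index_enum T) Q) ?index_enum_uniq// => z _; rewrite mem_index_enum.
Qed.

Lemma sum_observable1 {T : finType} {Z : Omega X x0 -> T} :
  observable Z -> \sum_z Pr mu [set om | Z om = z] = 1.
Proof.
move=> mZ; rewrite -(Pr_sum predT mZ) -Pr_setT.
by congr (Pr mu _); apply/seteqP.
Qed.

(** Change of variables: the values of [Z] are grouped by their image under [phi]. *)
Lemma EX_comp {T U : finType} {Z : Omega X x0 -> T} (phi : T -> U) (F : U -> R) :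
  observable Z ->
  \sum_z Pr mu [set om | Z om = z] * F (phi z)
  = \sum_u Pr mu [set om | phi (Z om) = u] * F u.
Proof.
move=> mZ; rewrite (partition_big phi predT)//=; apply: eq_bigr => u _.
have -> : [set om | phi (Z om) = u] = [set om | (fun z => phi z == u) (Z om)].
  by apply/seteqP; split => om /= /eqP.
rewrite (Pr_sum (fun z => phi z == u) mZ) mulr_suml.
by apply: eq_bigr => z /eqP ->.
Qed.

(** A read depends on finitely many coordinates. A general [J] covers the full sigma-algebra as well
    as the past and future ones used for mixing. *)
Lemma sigma_read (J : set int) (l : nat) (i : int) (x : {ffun 'I_l -> X}) :
  (forall j : 'I_l, J (i + j%:Z)) ->
  <<s coord_events X x0 J >> [set om : Omega X x0 | read l om i = x].
Proof.
move=> HJ.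
have -> : [set om : Omega X x0 | read l om i = x] =
    \bigcap_(j in [set: 'I_l]) [set om : Omega X x0 | om (i + j%:Z) = x j].
  apply/seteqP; split => [om /= <- j _ /=|om /= H].
    by rewrite ffunE.
  by apply/ffunP => j; rewrite ffunE; apply: (H j).
apply: (@fin_bigcap_measurable _ (g_sigma_algebraType (coord_events X x0 J))) => //.
move=> j _; apply: sub_sigma_algebra.
by exists (i + j%:Z), (x j).
Qed.

Lemma observable_read l i : observable (fun om : Omega X x0 => read l om i).
Proof. by move=> x; apply: sigma_read. Qed.

Definition wpmf l (w : {ffun 'I_l -> X}) := Pr mu [set om : Omega X x0 | read l om 0 = w].

Lemma read_shift l (om : Omega X x0) i : read l (Defs.shift X x0 om) i = read l om (i + 1).
Proof. by apply/ffunP => j; rewrite !ffunE /=; congr (om _); lia. Qed.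

Lemma Pr_read l i w : stationary mu ->
  Pr mu [set om : Omega X x0 | read l om i = w] = wpmf l w.
Proof.
move=> st.
have S j : Pr mu [set om : Omega X x0 | read l om (j + 1) = w] =
           Pr mu [set om : Omega X x0 | read l om j = w].
  rewrite /Pr -(st [set om : Omega X x0 | read l om j = w]); last exact: observable_read.
  congr (fine (mu _)); apply/seteqP; split => om /=; by rewrite read_shift.
elim/int_rec: i => [//|n IH|n IH].
  by rewrite -addn1 PoszD S.
by rewrite -IH -(S (- n.+1%:Z)); congr (Pr mu _); apply/seteqP; split => om /=;
  rewrite (_ : - n.+1%:Z + 1 = - n%:Z)//; lia.
Qed.

End Observables.

(** * Mixing *)

Section Mixing.
Context {R : realType} {X : finType} {x0 : X} (mu : probability (Omega X x0) R).
Hypothesis st : stationary mu.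

Lemma sigma_coord_measurable (J : set int) (A : set (Omega X x0)) :
  <<s coord_events X x0 J >> A -> measurable A.
Proof.
move: A; apply: smallest_sub; first exact: smallest_sigma_algebra.
move=> A [j [a [_ ->]]]; apply: sub_sigma_algebra.
by exists j, a.
Qed.

Lemma mixing_coeff_ub s (i : int) (E F : set (Omega X x0)) :
  <<s past i >> E -> <<s future (i + s%:Z) >> F -> 0 < Pr mu E ->
  `| Pr mu (F `&` E) / Pr mu E - Pr mu F | <= mixing_coeff mu s.
Proof.
move=> HE HF PE; apply: ub_le_sup; last by exists i, E, F.
(* The supremum is genuine because the set is bounded: each value is the distance of two numbers in
   [0, 1]. *)
exists 1 => _ [i' [E' [F' [sE [sF [PE' ->]]]]]].
have mE := sigma_coord_measurable _ _ sE; have mF := sigma_coord_measurable _ _ sF.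
have h1 : 0 <= Pr mu (F' `&` E') / Pr mu E' <= 1.
  rewrite divr_ge0 ?Pr_ge0//= ler_pdivrMr// mul1r.
  by apply: Pr_le => //; exact: measurableI.
have h2 : 0 <= Pr mu F' <= 1 by rewrite Pr_ge0 Pr_le1.
by rewrite ler_norml; lra.
Qed.

Lemma mixing_joint s (i : int) (E F : set (Omega X x0)) :
  <<s past i >> E -> <<s future (i + s%:Z) >> F ->
  `| Pr mu (F `&` E) - Pr mu E * Pr mu F | <= mixing_coeff mu s * Pr mu E.
Proof.
move=> HE HF.
have mE := sigma_coord_measurable _ _ HE; have mF := sigma_coord_measurable _ _ HF.
have [PE|] := ltP 0 (Pr mu E).
  have := mixing_coeff_ub s i E F HE HF PE.
  have -> : Pr mu (F `&` E) - Pr mu E * Pr mu F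
          = (Pr mu (F `&` E) / Pr mu E - Pr mu F) * Pr mu E.
    by field; rewrite gt_eqF.
  by rewrite normrM (gtr0_norm PE) ler_pM2r.
move=> PE; have PE0 : Pr mu E = 0 by apply/eqP; rewrite eq_le PE Pr_ge0.
have : Pr mu (F `&` E) <= Pr mu E by apply: Pr_le => //; exact: measurableI.
rewrite PE0 => PFE; have -> : Pr mu (F `&` E) = 0.
  by apply/eqP; rewrite eq_le PFE Pr_ge0.
by rewrite mul0r mulr0 subr0 normr0.
Qed.

(** The gap [s] is counted from the last letter of the first read, at position [i + k - 1]. *)
Lemma mixing_reads s k l (i j : int) (a : {ffun 'I_k -> X}) (b : {ffun 'I_l -> X}) :
  i + k%:Z - 1 + s%:Z <= j ->
  `| Pr mu [set om | (read k om i, read l om j) = (a, b)] - wpmf mu k a * wpmf mu l b |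
  <= mixing_coeff mu s * wpmf mu k a.
Proof.
move=> ij; rewrite -(Pr_read mu k i)// -(Pr_read mu l j)//.
have -> : [set om : Omega X x0 | (read k om i, read l om j) = (a, b)] =
  [set om : Omega X x0 | read l om j = b] `&` [set om | read k om i = a].
  by apply/seteqP; split => om /= [-> ->].
apply: (mixing_joint s (i + k%:Z - 1)).
  by apply: sigma_read => r /=; have := ltn_ord r; lia.
by apply: sigma_read => r /=; lia.
Qed.

Lemma wpmf_ge0 k a : 0 <= wpmf mu k a. Proof. exact: Pr_ge0. Qed.

Lemma wpmf_le1 k a : wpmf mu k a <= 1.
Proof. by apply: Pr_le1; exact: observable_read. Qed.

Lemma sum_wpmf k : \sum_a wpmf mu k a = 1.
Proof. by apply: sum_observable1; exact: observable_read. Qed.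

Lemma EX_read (k : nat) (i : int) (F : {ffun 'I_k -> X} -> R) :
  \sum_a Pr mu [set om : Omega X x0 | read k om i = a] * F a = \sum_a wpmf mu k a * F a.
Proof. by apply: eq_bigr => a _; rewrite Pr_read. Qed.

Lemma Pr_read_pred (k : nat) (i : int) (Q : pred {ffun 'I_k -> X}) :
  Pr mu [set om : Omega X x0 | Q (read k om i)] = \sum_(a | Q a) wpmf mu k a.
Proof.
rewrite (Pr_sum _ _ (observable_read k i)).
by apply: eq_bigr => a _; rewrite Pr_read.
Qed.

(** The default [x0] is never read when [off + l <= N]. *)
Definition subword {N : nat} (l off : nat) (w : {ffun 'I_N -> X}) : {ffun 'I_l -> X} :=
  [ffun r : 'I_l => if insub (off + r)%N is Some i then w i else x0].

Lemma subword_read N l off (om : Omega X x0) i : (off + l <= N)%N ->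
  subword l off (read N om i) = read l om (i + off%:Z).
Proof.
move=> H; apply/ffunP => r; rewrite !ffunE.
have Hr : (off + r < N)%N by have := ltn_ord r; lia.
by rewrite insubT ffunE /= PoszD addrA.
Qed.

Lemma EX_subword N l off (F : {ffun 'I_l -> X} -> R) : (off + l <= N)%N ->
  \sum_w wpmf mu N w * F (subword l off w) = \sum_a wpmf mu l a * F a.
Proof.
move=> H; rewrite (EX_comp mu (subword l off) F (observable_read N 0)).
rewrite -(EX_read l (0 + off%:Z)); apply: eq_bigr => a _; congr (Pr mu _ * _).
by apply/seteqP; split => om /=; rewrite subword_read.
Qed.

(** As [g] is centred, the product law contributes zero. Mixing bounds the remaining difference of
    laws pair by pair, and summing over the second word costs the cardinality factor. *)
Lemma cov_le s k (i j : int) (g : {ffun 'I_k -> X} -> R) (M : R) :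
  i + k%:Z - 1 + s%:Z <= j -> 0 <= mixing_coeff mu s ->
  (forall a, `|g a| <= M) -> \sum_a wpmf mu k a * g a = 0 ->
  \sum_ab Pr mu [set om | (read k om i, read k om j) = ab] * (g ab.1 * g ab.2)
  <= M ^+ 2 * #|{ffun 'I_k -> X}|%:R * mixing_coeff mu s.
Proof.
move=> ij d0 gM g0.
rewrite (eq_bigr (fun ab => Pr mu [set om | (read k om i, read k om j) = (ab.1, ab.2)]
  * (g ab.1 * g ab.2))); last by move=> [].
rewrite -(pair_bigA _ (fun a b => Pr mu [set om | (read k om i, read k om j) = (a, b)] * (g a * g b)))/=.
have -> : \sum_a \sum_b Pr mu [set om | (read k om i, read k om j) = (a, b)] * (g a * g b)
  = \sum_a \sum_b (Pr mu [set om | (read k om i, read k om j) = (a, b)]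
       - wpmf mu k a * wpmf mu k b) * (g a * g b).
  apply/eqP; rewrite -subr_eq0 -sumrB; apply/eqP.
  under eq_bigr do rewrite -sumrB.
  transitivity (\sum_a wpmf mu k a * g a * \sum_b wpmf mu k b * g b).
    by apply: eq_bigr => a _; rewrite mulr_sumr; apply: eq_bigr => b _; ring.
  by rewrite g0; rewrite big1// => a _; rewrite mulr0.
have M0 : 0 <= M by apply: le_trans (gM [ffun=> x0]); exact: normr_ge0.
apply: (@le_trans _ _ (\sum_a \sum_(b : {ffun 'I_k -> X}) mixing_coeff mu s * wpmf mu k a * M ^+ 2)).
  apply: ler_sum => a _; apply: ler_sum => b _.
  apply: (le_trans (ler_norm _)); rewrite !normrM expr2.
  apply: ler_pM; rewrite ?mulr_ge0//.
    exact: mixing_reads.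
  exact: ler_pM.
under eq_bigr do rewrite sumr_const.
rewrite sumrMnl -!mulr_suml -mulr_sumr sum_wpmf mulr1 -mulr_natr.
by rewrite le_eqVlt; apply/orP; left; apply/eqP; ring.
Qed.

End Mixing.

(** * A weak law of large numbers for blocks *)

Lemma sum_near_le (i S m : nat) :
  (\sum_(j < m) ((i < j + S) && (j < i + S)) <= 2 * S)%N.
Proof.
(* Strengthened to a count in the interval cut off at [m], so that induction on [m] goes through. *)
suff : (\sum_(j < m) ((i < j + S) && (j < i + S)) <= minn m (i + S) - (i - S))%N by lia.
elim: m => [|m IH]; first by rewrite big_ord0.
by rewrite big_ord_recr /=; case: (boolP (_ && _)); move: IH => /=; lia.
Qed.

Section LawOfLargeNumbers.
Context {R : realType} {X : finType} {x0 : X} (mu : probability (Omega X x0) R).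
Hypothesis st : stationary mu.
Hypothesis mix0 : forall e : R, 0 < e ->
  exists S : nat, forall s, (S <= s)%N -> mixing_coeff mu s <= e.

Local Notation p := (wpmf mu).

Lemma mixing_coeff_ge0 s : 0 <= mixing_coeff mu s.
Proof.
have T0 : forall J, <<s coord_events X x0 J >> setT.
  by move=> J; exact: (@measurableT _ (g_sigma_algebraType (coord_events X x0 J))).
apply: le_trans (mixing_coeff_ub mu s 0 setT setT (T0 _) (T0 _) _); first exact: normr_ge0.
by rewrite Pr_setT ltr01.
Qed.

Definition block k m (w : {ffun 'I_(m * k) -> X}) (j : nat) : {ffun 'I_k -> X} :=
  subword (x0 := x0) k (j * k) w.
Arguments block : clear implicits.

Lemma block_fits k m (j : 'I_m) : (j * k + k <= m * k)%N.
Proof. by rewrite -mulSnr leq_mul2r ltn_ord orbT. Qed.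

Lemma EX_block2 k m (i j : 'I_m) (g : {ffun 'I_k -> X} -> R) :
  \sum_w p (m * k) w * (g (block k m w i) * g (block k m w j)) =
  \sum_ab Pr mu [set om | (read k om (i * k)%:Z, read k om (j * k)%:Z) = ab] * (g ab.1 * g ab.2).
Proof.
rewrite (EX_comp mu (fun w => (block k m w i, block k m w j)) (fun ab => g ab.1 * g ab.2)
  (observable_read (m * k) 0)).
apply: eq_bigr => ab _; congr (Pr mu _ * _); apply/seteqP.
by split => om /=; rewrite /block !subword_read ?block_fits// !add0r.
Qed.

(** Blocks at index distance less than [S] get the trivial bound [M ^+ 2]; the others are
    decorrelated by mixing. *)
Lemma cov_block_le S e k m (i j : 'I_m) (g : {ffun 'I_k -> X} -> R) (M : R) :
  (0 < k)%N -> (0 < S)%N -> (forall s, (S <= s)%N -> mixing_coeff mu s <= e) ->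
  (forall a, `|g a| <= M) -> \sum_a p k a * g a = 0 -> 0 <= e ->
  \sum_w p (m * k) w * (g (block k m w i) * g (block k m w j)) <=
  M ^+ 2 * ((i < j + S)%N && (j < i + S)%N)%:R + M ^+ 2 * #|{ffun 'I_k -> X}|%:R * e.
Proof.
move=> k0 S0 He gM g0 e0.
have M0 : 0 <= M by apply: le_trans (gM [ffun=> x0]); exact: normr_ge0.
have C0 : 0 <= M ^+ 2 * #|{ffun 'I_k -> X}|%:R by rewrite mulr_ge0 ?sqr_ge0.
wlog ij : i j / (i <= j)%N.
  move=> H; have [ij|/ltnW ij] := leqP i j; first exact: H.
  by rewrite andbC; under eq_bigr do rewrite [g _ * g _]mulrC; exact: H.
case: (boolP (_ && _)) => near /=.
  rewrite mulr1 ler_wpDr// ?mulr_ge0//.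
  rewrite -[leRHS]mul1r -(sum_wpmf mu (m * k)) mulr_suml; apply: ler_sum => w _.
  rewrite ler_wpM2l ?wpmf_ge0// (le_trans (ler_norm _))// normrM expr2.
  exact: ler_pM.
rewrite mulr0 add0r EX_block2.
(* The index distance [j - i] is a valid gap in letters, since every block has at least one
   letter. *)
apply: le_trans (cov_le mu st (j - i) k _ _ g M _ (mixing_coeff_ge0 _) gM g0) _.
  suff : (i * k + k + (j - i) <= j * k + 1)%N by lia.
  have : (i < j)%N by move: near; lia.
  by case: k {g gM g0 C0} k0 => // k _; nia.
by rewrite ler_wpM2l// He//; move: near; lia.
Qed.

(** In the expanded square the near pairs number only of order [m], against [m ^ 2] in total, and
    mixing makes the far covariances uniformly small. *)
Lemma variance_le k (g : {ffun 'I_k -> X} -> R) (e : R) :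
  (0 < k)%N -> \sum_a p k a * g a = 0 -> 0 < e ->
  exists m0, forall m, (m0 <= m)%N ->
  \sum_w p (m * k) w * (\sum_(j < m) g (block k m w j)) ^+ 2 <= e * m%:R ^+ 2.
Proof.
move=> k0 g0 e0.
pose M := \sum_a `|g a|.
have gM a : `|g a| <= M by rewrite /M (bigD1 a)//= lerDl sumr_ge0.
have M0 : 0 <= M by rewrite sumr_ge0.
pose C := M ^+ 2 * #|{ffun 'I_k -> X}|%:R.
have C0 : 0 <= C by rewrite mulr_ge0 ?sqr_ge0.
(* Ensures [C * e1 <= e / 2]; the [+ 1] keeps the denominator positive. *)
pose e1 := e / (2 * (C + 1)).
have e10 : 0 < e1 by rewrite divr_gt0// mulr_gt0// ltr_wpDl.
have [S0 HS0] := mix0 e1 e10.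
pose S := S0.+1.
have HS s : (S <= s)%N -> mixing_coeff mu s <= e1 by move=> /ltnW; exact: HS0.
exists (Num.truncn (2 * (M ^+ 2 * (2 * S)%:R) / e)).+1 => m Hm.
have {}Hm : 2 * (M ^+ 2 * (2 * S)%:R) <= e * m%:R.
  rewrite [leRHS]mulrC -ler_pdivrMr//; apply: ltW; apply: lt_le_trans (truncnS_gt _) _.
  by rewrite ler_nat.
have -> : \sum_w p (m * k) w * (\sum_(j < m) g (block k m w j)) ^+ 2 =
  \sum_(i < m) \sum_(j < m) \sum_w p (m * k) w * (g (block k m w i) * g (block k m w j)).
  under [RHS]eq_bigr do rewrite exchange_big /=.
  rewrite [RHS]exchange_big /=; apply: eq_bigr => w _.
  rewrite expr2 mulr_suml mulr_sumr; apply: eq_bigr => i _.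
  by rewrite mulr_sumr mulr_sumr.
apply: (@le_trans _ _ (\sum_(i < m) (M ^+ 2 * (2 * S)%:R + m%:R * (C * e1)))).
  apply: ler_sum => i _.
  apply: (@le_trans _ _ (\sum_(j < m) (M ^+ 2 * ((i < j + S)%N && (j < i + S)%N)%:R + C * e1))).
    by apply: ler_sum => j _; apply: cov_block_le => //; exact: ltW.
  rewrite big_split /= -mulr_sumr sumr_const card_ord mulr_natl lerD2r ler_wpM2l ?sqr_ge0//.
  by rewrite -natr_sum ler_nat sum_near_le.
rewrite sumr_const card_ord -mulr_natl.
have Ce1 : C * e1 <= e / 2.
  rewrite /e1 mulrA ler_pdivrMr ?mulr_gt0 ?ltr_wpDl//.
  by rewrite (_ : e / 2 * _ = C * e + e); [rewrite lerDl ltW|field].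
have m0 : 0 <= m%:R :> R by [].
by rewrite expr2; nra.
Qed.

(** Chebyshev's inequality for the centred block sums. *)
Lemma block_lln k (F : {ffun 'I_k -> X} -> R) (u gam : R) :
  (0 < k)%N -> 0 < u -> 0 < gam ->
  exists m0, forall m, (m0 <= m)%N ->
  \sum_(w | m%:R * (\sum_a p k a * F a + u) < \sum_(j < m) F (block k m w j)) p (m * k) w <= gam.
Proof.
move=> k0 u0 gam0; set EF := \sum_a _.
pose g a := F a - EF.
have g0 : \sum_a p k a * g a = 0.
  under eq_bigr do rewrite mulrBr.
  by rewrite sumrB -mulr_suml sum_wpmf mul1r subrr.
have [|m0 H] := variance_le k g (gam * u ^+ 2) k0 g0; first by rewrite mulr_gt0 ?exprn_gt0.
exists m0.+1 => m Hm.
have m1 : 0 < m%:R :> R by rewrite ltr0n; lia.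
have mu0 : 0 < (m%:R * u) ^+ 2 by rewrite exprn_gt0// mulr_gt0.
rewrite -(ler_pM2r mu0) mulr_suml.
apply: (@le_trans _ _ (gam * u ^+ 2 * m%:R ^+ 2)); last by rewrite exprMn; lra.
apply: le_trans (H m (ltnW Hm)).
rewrite big_mkcond; apply: ler_sum => w _; case: ifPn => [Hw|_].
  rewrite ler_wpM2l ?wpmf_ge0//.
  have E : \sum_(j < m) g (block k m w j) = \sum_(j < m) F (block k m w j) - m%:R * EF.
    by rewrite sumrB sumr_const card_ord mulr_natl.
  have mu1 : 0 <= m%:R * u by rewrite mulr_ge0// ltW.
  have mS : m%:R * u <= \sum_(j < m) g (block k m w j) by rewrite E; move: Hw; rewrite mulrDr; lra.
  by rewrite ler_sqr// nnegrE// (le_trans mu1).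
by rewrite mulr_ge0 ?wpmf_ge0 ?sqr_ge0.
Qed.

End LawOfLargeNumbers.

(** * Asymptotic equipartition *)

Section Typicality.
Context {R : realType} {X : finType} {x0 : X} (mu : probability (Omega X x0) R).
Hypothesis st : stationary mu.
Hypothesis mix0 : forall e : R, 0 < e ->
  exists S : nat, forall s, (S <= s)%N -> mixing_coeff mu s <= e.

Local Notation p := (wpmf mu).

(** In natural logarithms, unlike [shannon]; words of probability zero contribute 0. *)
Definition entropy k : R := \sum_a p k a * - ln (p k a).

Lemma wpmf_le_subword N l off w : (off + l <= N)%N -> p N w <= p l (subword (x0 := x0) l off w).
Proof.
move=> H; rewrite -(Pr_read mu l off%:Z)//.
apply: Pr_le; [exact: observable_read|exact: observable_read|].
by move=> om /= <-; rewrite subword_read// add0r.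
Qed.

(** Cutting a word into blocks is injective, so the sum is part of the expansion of the [m]-th power
    of the total mass 1. *)
Lemma sum_prod_block k m :
  (0 < k)%N -> \sum_w \prod_(j < m) p k (block (x0 := x0) k m w j) <= 1.
Proof.
move=> k0.
pose phi (w : {ffun 'I_(m * k) -> X}) := [ffun j : 'I_m => block (x0 := x0) k m w j].
have phi_inj : injective phi.
  move=> w v /ffunP E; apply/ffunP => i.
  have Hq : (i %/ k < m)%N by rewrite ltn_divLR.
  have Hr : (i %% k < k)%N by rewrite ltn_mod.
  have := E (Ordinal Hq); rewrite !ffunE => /ffunP /(_ (Ordinal Hr)).
  rewrite !ffunE /= -divn_eq insubT// => Hi.
  by rewrite (_ : Sub (nat_of_ord i) Hi = i)//; apply/val_inj.
rewrite [leRHS](_ : 1 = \sum_(F : {ffun 'I_m -> {ffun 'I_k -> X}}) \prod_(j < m) p k (F j)); last first.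
  rewrite -(bigA_distr_bigA (fun (_ : 'I_m) a => p k a)) /= big1// => j _.
  exact: sum_wpmf.
rewrite (eq_bigr (fun w => \prod_(j < m) p k (phi w j))); last first.
  by move=> w _; apply: eq_bigr => j _; rewrite ffunE.
rewrite -(big_imset (fun F : {ffun 'I_m -> {ffun 'I_k -> X}} => \prod_(j < m) p k (F j)) (A := predT) (h := phi)) /=;
  last by move=> ? ? _ _; exact: phi_inj.
rewrite [leRHS](bigID (fun F => F \in imset phi (mem predT))) /=.
rewrite lerDl sumr_ge0// => F _; apply: prodr_ge0 => j _; exact: wpmf_ge0.
Qed.

(* The product of block probabilities has total mass at most 1, so the event that
   [p] is below [exp (- m u / 2)] times it has probability at most [exp (- m u / 2)]. *)
Lemma block_lower k (u gam : R) : (0 < k)%N -> 0 < u -> 0 < gam ->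
  exists m0, forall m, (m0 <= m)%N ->
  \sum_(w | p (m * k) w < expR (- (m%:R * (entropy k + u)))) p (m * k) w <= gam.
Proof.
move=> k0 u0 gam0.
have [||m0 H] := block_lln mu st mix0 k (fun a => - ln (p k a)) (u / 2) (gam / 2) k0; rewrite ?divr_gt0//.
exists (maxn m0 (Num.truncn (4 / (gam * u))).+1) => m; rewrite geq_max => /andP[Hm1 Hm2].
have {}H := H m Hm1.
have {}Hm2 : 4 <= gam * u * m%:R.
  rewrite mulrC -ler_pdivrMr ?mulr_gt0//; apply: ltW; apply: lt_le_trans (truncnS_gt _) _.
  by rewrite ler_nat.
have m_gt0 : 0 < m%:R :> R.
  by rewrite lt0r ler0n andbT; apply: contraTneq Hm2 => ->; rewrite mulr0 -ltNge.
have expu : expR (- (m%:R * (u / 2))) <= gam / 2.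
  have mu0 : 0 < m%:R * (u / 2) by rewrite mulr_gt0 ?divr_gt0.
  rewrite expRN -[leRHS]invrK lef_pV2 ?posrE ?expR_gt0 ?invr_gt0 ?divr_gt0//.
  apply: le_trans (expR_ge1Dx _).
  rewrite invf_div ler_pdivrMr//; nra.
(* Off [typ] the block sum exceeds its mean by more than [m u / 2], which [block_lln] makes
   unlikely; on [typ] the comparison with the product applies. Each part costs [gam / 2]. *)
pose typ w := \sum_(j < m) - ln (p k (block (x0 := x0) k m w j)) <= m%:R * (entropy k + u / 2).
rewrite (bigID typ) /= [leRHS](_ : _ = gam / 2 + gam / 2); last by field.
apply: lerD; last first.
  apply: le_trans H; rewrite [leRHS]big_mkcond [leLHS]big_mkcond /=; apply: ler_sum => w _.
  rewrite -ltNge; case: (_ < expR _) => /=; first by [].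
  by case: ifP => // _; exact: wpmf_ge0.
apply: le_trans expu.
rewrite -[leRHS]mulr1 -[leRHS]/(_ * 1).
apply: le_trans (ler_wpM2l (expR_ge0 _) (sum_prod_block k m k0)).
rewrite mulr_sumr big_mkcond /=; apply: ler_sum => w _.
have Q0 : 0 <= \prod_(j < m) p k (block (x0 := x0) k m w j).
  by apply: prodr_ge0 => j _; exact: wpmf_ge0.
case: ifPn => [/andP[lt_w typ_w]|_]; last by rewrite mulr_ge0 ?expR_ge0.
have [->|/eqP pw0] := eqVneq (p (m * k) w) 0; first by rewrite mulr_ge0 ?expR_ge0.
have {}pw0 : 0 < p (m * k) w by rewrite lt0r wpmf_ge0 andbT; apply/eqP.
have pb0 (j : 'I_m) : 0 < p k (block (x0 := x0) k m w j).
  by apply: lt_le_trans pw0 _; apply: wpmf_le_subword; exact: block_fits.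
rewrite (eq_bigr (fun j : 'I_m => expR (ln (p k (block (x0 := x0) k m w j))))); last first.
  by move=> j _; rewrite lnK ?posrE.
rewrite -expR_sum -expRD (le_trans (ltW lt_w))// ler_expR.
move: typ_w; rewrite /typ sumrN; lra.
Qed.

Lemma Pr_read_sub_le N l (Q : pred {ffun 'I_l -> X}) (Q' : pred {ffun 'I_N -> X}) : (l <= N)%N ->
  (forall w, Q (subword (x0 := x0) l 0 w) -> Q' w) ->
  \sum_(a | Q a) p l a <= \sum_(w | Q' w) p N w.
Proof.
move=> lN QQ'; rewrite -!(Pr_read_pred mu st _ 0).
apply: Pr_le; [exact: (observable_set Q (observable_read _ _))|
  exact: (observable_set Q' (observable_read _ _))|].
by move=> om /= Hq; apply: QQ'; rewrite subword_read// add0r.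
Qed.

Variable h : R.
Hypothesis h_ge0 : 0 <= h.
(** Only odd lengths occur, because the rates are defined on the symmetric windows of length
    [2 t + 1]. *)
Hypothesis entropy_rate : forall e, 0 < e -> exists t0 : nat, forall t, (t0 <= t)%N ->
  `| entropy (2 * t).+1 - (2 * t).+1%:R * h | <= (2 * t).+1%:R * e.

(** Extend the word to the next multiple of a fixed block length [k]: the longer word is no more
    probable than its prefix, and the at most [k] added letters are absorbed by [e]. *)
Lemma typical_lower (e gam : R) : 0 < e -> 0 < gam ->
  exists l0, forall l, (l0 <= l)%N ->
  \sum_(a | p l a < expR (- (l%:R * (h + e)))) p l a <= gam.
Proof.
move=> e0 gam0.
have [|t0 /(_ t0 (leqnn _))] := entropy_rate (e / 4); first by rewrite divr_gt0.
set k := (2 * t0).+1 => Hk.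
have k0 : 0 < k%:R :> R by [].
(* Per letter, [e / 4] goes to the entropy rate and [e / 4] to the deviation; the remaining [e / 2]
   pays for the rounding of [l]. *)
have [|m0 H] := block_lower k (k%:R * (e / 4)) gam isT _ gam0.
  by rewrite mulr_gt0 ?divr_gt0.
exists (maxn (m0 * k) (Num.truncn (2 * (k%:R * (h + e / 2)) / e)).+1) => l; rewrite geq_max => /andP[Hl1 Hl2].
have {}Hl2 : 2 * (k%:R * (h + e / 2)) <= e * l%:R.
  rewrite [leRHS]mulrC -ler_pdivrMr//; apply: ltW; apply: lt_le_trans (truncnS_gt _) _.
  by rewrite ler_nat.
pose m := (l %/ k).+1.
have lN : (l <= m * k)%N by rewrite ltnW// -ltn_divLR.
have Nl : (m * k <= l + k)%N by rewrite mulSn addnC leq_add2r leq_trunc_div.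
have mm : (m0 <= m)%N by rewrite leqW// leq_divRL.
apply: le_trans (H m mm).
apply: (Pr_read_sub_le (m * k) l) => // w /= Hw.
apply: (le_lt_trans (wpmf_le_subword (m * k) l 0 w lN)); apply: (lt_le_trans Hw).
rewrite ler_expR lerN2.
have NlR : m%:R * k%:R <= l%:R + k%:R :> R by rewrite -natrM -natrD ler_nat.
have m_ge0 : 0 <= m%:R :> R by [].
have Hk' : entropy k + k%:R * (e / 4) <= k%:R * (h + e / 2).
  by move: Hk; rewrite ler_norml => /andP[_]; lra.
apply: (le_trans (ler_wpM2l m_ge0 Hk')).
have he : 0 <= h + e / 2 by rewrite addr_ge0// divr_ge0// ltW.
have := ler_wpM2r he NlR; lra.
Qed.

Variable M : R.
Hypothesis support_bound : exists l0, forall l, (l0 <= l)%N ->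
  forall a, 0 < p l a -> - ln (p l a) <= l%:R * M.

(** If [A], the set of too probable words, had mass above [gam], then the mean of [- ln p] would
    fall below the entropy, since [- ln p] is rarely above [l (h + e1)] and then still at most
    [l M]. *)
Lemma typical_upper_odd (e gam : R) : 0 < e -> 0 < gam ->
  exists t0, forall t, (t0 <= t)%N ->
  let l := (2 * t).+1 in
  \sum_(a | expR (- (l%:R * (h - e))) < p l a) p l a <= gam.
Proof.
move=> e0 gam0.
pose M1 := Num.max M 1.
have M10 : 0 < M1 by rewrite lt_max ltr01 orbT.
have [l1 H1] := support_bound.
pose e1 := e * gam / 4.
have e10 : 0 < e1 by rewrite divr_gt0// mulr_gt0.
have [|l2 H2] := typical_lower e1 (e * gam / (2 * M1)) e10.
  by rewrite divr_gt0 ?mulr_gt0.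
have [t3 H3] := entropy_rate e1 e10.
exists (maxn (maxn l1 l2) t3) => t; rewrite !geq_max => /andP[/andP[Ht1 Ht2] Ht3] /=.
set l := (2 * t).+1.
have {}H1 := H1 l ltac:(lia).
have {}H2 := H2 l ltac:(lia).
have {}H3 := H3 t Ht3; rewrite -/l in H3.
have l0 : 0 < l%:R :> R by [].
pose A a := expR (- (l%:R * (h - e))) < p l a.
pose B a := p l a < expR (- (l%:R * (h + e1))).
(* Relative to [l (h + e1)], words in [A] fall short by at least [l e], and words in [B] exceed it
   by at most [l M1]. *)
have pt a : p l a * - ln (p l a) <=
   p l a * (l%:R * (h + e1)) - l%:R * e * (if A a then p l a else 0)
    + l%:R * M1 * (if B a then p l a else 0).
  have [->|/eqP pa0] := eqVneq (p l a) 0.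
    by rewrite !if_same !mul0r !mulr0 subr0 addr0.
  have {}pa0 : 0 < p l a by rewrite lt0r wpmf_ge0 andbT; apply/eqP.
  have a1 : - ln (p l a) <= l%:R * M1.
    by apply: le_trans (H1 a pa0) _; rewrite ler_wpM2l ?ler0n// le_max lexx.
  have E : forall (b : bool), (if b then p l a else 0) = p l a * b%:R.
    by case; rewrite ?mulr1 ?mulr0.
  rewrite !E.
  suff : - ln (p l a) <= l%:R * (h + e1) - l%:R * e * (A a)%:R + l%:R * M1 * (B a)%:R.
    move=> /(ler_wpM2l (ltW pa0)) /le_trans; apply.
    by rewrite le_eqVlt; apply/orP; left; apply/eqP; ring.
  have lM1 : 0 <= l%:R * M1 by rewrite mulr_ge0// ltW.
  have lhe : 0 <= l%:R * (h + e1) by rewrite mulr_ge0// addr_ge0// ltW.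
  case HA : (A a).
    have : - ln (p l a) <= l%:R * (h - e).
      by rewrite lerNl -[leLHS]expRK ler_ln ?posrE ?expR_gt0// ltW.
    have : 0 <= l%:R * e1 by rewrite mulr_ge0// ltW.
    have : 0 <= l%:R * M1 * (B a)%:R by rewrite mulr_ge0.
    rewrite /=; lra.
  case HB : (B a); first by rewrite /=; lra.
  have : - ln (p l a) <= l%:R * (h + e1).
    by rewrite lerNl -[leLHS]expRK ler_ln ?posrE ?expR_gt0// leNgt; rewrite /B in HB; rewrite HB.
  rewrite /=; lra.
have : entropy l <= l%:R * (h + e1) - l%:R * e * (\sum_(a | A a) p l a)
    + l%:R * M1 * (\sum_(a | B a) p l a).
  apply: le_trans (ler_sum _ (fun a _ => pt a)) _.
  rewrite big_split sumrB /= -!mulr_sumr -mulr_suml sum_wpmf mul1r.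
  by rewrite -!big_mkcond.
move: H3; rewrite ler_norml => /andP[H3 _] H4.
set q := \sum_(a | A a) _ in H4 *; set r := \sum_(a | B a) _ in H4.
have M1r : M1 * r <= e * gam / 2.
  apply: le_trans (ler_wpM2l (ltW M10) H2) _.
  by rewrite le_eqVlt; apply/orP; left; apply/eqP; field; rewrite gt_eqF.
have {H3 H4} : l%:R * (h - e1) <= l%:R * (h + e1 - e * q + M1 * r) by lra.
rewrite ler_pM2l// => H5.
rewrite -(ler_pM2l e0); rewrite /e1 in H5; lra.
Qed.

(** Pass to the longest odd prefix: it is at least as probable and loses at most one letter, which
    half of [e] absorbs. *)
Lemma typical_upper (e gam : R) : 0 < e -> 0 < gam ->
  exists l0, forall l, (l0 <= l)%N ->
  \sum_(a | expR (- (l%:R * (h - e))) < p l a) p l a <= gam.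
Proof.
move=> e0 gam0.
have [|t0 H] := typical_upper_odd (e / 2) gam _ gam0; first by rewrite divr_gt0.
exists (maxn (2 * t0).+2 (Num.truncn (2 * h / e)).+1) => l; rewrite geq_max => /andP[Hl1 Hl2].
have {}Hl2 : 2 * h <= e * l%:R.
  rewrite [leRHS]mulrC -ler_pdivrMr//; apply: ltW; apply: lt_le_trans (truncnS_gt _) _.
  by rewrite ler_nat.
pose t := (l.-1)./2.
apply: le_trans (H t ltac:(lia)) => /=.
rewrite -!(Pr_read_pred mu st _ 0).
apply: Pr_le; [exact: (observable_set (fun a => _ < p _ a) (observable_read _ _))|
  exact: (observable_set (fun a => _ < p _ a) (observable_read _ _))|].
have lN : (0 + (2 * t).+1 <= l)%N by lia.
move=> om /= Hq; rewrite -[X in read _ _ X](add0r 0%:Z) -(subword_read l _ 0)//.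
apply: (lt_le_trans _ (wpmf_le_subword l _ 0 _ lN)); apply: le_lt_trans Hq.
rewrite ler_expR lerN2.
have : l = (2 * t).+1 \/ l = (2 * t).+2 by lia.
case=> lE.
  rewrite -lE ler_wpM2l//; lra.
move: Hl2; have -> : l%:R = (2 * t).+1%:R + 1 :> R by rewrite natr1 -lE.
lra.
Qed.

End Typicality.

(** * Pairs of reads *)

Section Pairs.
Context {R : realType} {X : finType} {x0 : X} (mu : probability (Omega X x0) R).
Hypothesis st : stationary mu.

Local Notation p := (wpmf mu).

Lemma Pr_orb {T : finType} {Z : Omega X x0 -> T} (Q1 Q2 : pred T) : observable Z ->
  Pr mu [set om | Q1 (Z om) || Q2 (Z om)] <=
  Pr mu [set om | Q1 (Z om)] + Pr mu [set om | Q2 (Z om)].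
Proof.
move=> mZ; rewrite (Pr_sum mu (fun z => Q1 z || Q2 z))// !(Pr_sum mu _ mZ).
rewrite big_mkcond [in leRHS]big_mkcond [X in _ + X]big_mkcond -big_split /=.
apply: ler_sum => z _; have := Pr_ge0 mu [set om | Z om = z].
by case: (Q1 z); case: (Q2 z) => /=; lra.
Qed.

Definition indep_mass l (D : pred ({ffun 'I_l -> X} * {ffun 'I_l -> X})) : R :=
  \sum_(xy | D xy) p l xy.1 * p l xy.2.

Lemma indep_mass_ge0 l D : 0 <= indep_mass l D.
Proof. by apply: sumr_ge0 => xy _; rewrite mulr_ge0 ?wpmf_ge0. Qed.

Lemma read_eq_at {l} {om om' : Omega X x0} {i z : int} :
  read l om i = read l om' i -> i <= z -> z < i + l%:Z -> om z = om' z.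
Proof.
move=> /ffunP E z1 z2; have Hz : (absz (z - i)%R < l)%N by lia.
have := E (Ordinal Hz); rewrite !ffunE /=.
by rewrite (_ : i + (absz (z - i)%R)%:Z = z)//; lia.
Qed.

(* The two reads cover the window of length [L] at [i], so they determine it; hence
   [C] bounds the likelihood ratio between overlapping and independent typical reads. *)
Lemma overlapping_pair_bound (l L : nat) (i1 i2 i : int)
    (D : pred ({ffun 'I_l -> X} * {ffun 'I_l -> X})) (theta Lam C gam : R) :
  (forall z : int, i <= z -> z < i + L%:Z ->
     (i1 <= z /\ z < i1 + l%:Z) \/ (i2 <= z /\ z < i2 + l%:Z)) ->
  0 <= theta -> 0 <= C -> Lam <= C * theta ^+ 2 ->
  \sum_(a | p l a < theta) p l a <= gam ->
  \sum_(w | Lam < p L w) p L w <= gam ->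
  1 - 3 * gam - C * indep_mass l (fun xy => ~~ D xy) <=
  Pr mu [set om | D (read l om i1, read l om i2)].
Proof.
move=> cover theta0 C0 HLam low up.
pose Z (om : Omega X x0) := (read l om i1, read l om i2, read L om i).
have mZ : observable Z by do 2?[apply: observable_pair]; exact: observable_read.
pose Q0 (z : {ffun 'I_l -> X} * {ffun 'I_l -> X} * {ffun 'I_L -> X}) := D z.1.
pose Q1 (z : {ffun 'I_l -> X} * {ffun 'I_l -> X} * {ffun 'I_L -> X}) := p l z.1.1 < theta.
pose Q2 (z : {ffun 'I_l -> X} * {ffun 'I_l -> X} * {ffun 'I_L -> X}) := p l z.1.2 < theta.
pose Q3 (z : {ffun 'I_l -> X} * {ffun 'I_l -> X} * {ffun 'I_L -> X}) := Lam < p L z.2.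
pose Q4 (z : {ffun 'I_l -> X} * {ffun 'I_l -> X} * {ffun 'I_L -> X}) :=
  ~~ D z.1 && ~~ Q1 z && ~~ Q2 z && ~~ Q3 z.
have P1 : Pr mu [set om | Q1 (Z om)] <= gam.
  by rewrite (Pr_read_pred mu st l i1 (fun a => p l a < theta)).
have P2 : Pr mu [set om | Q2 (Z om)] <= gam.
  by rewrite (Pr_read_pred mu st l i2 (fun a => p l a < theta)).
have P3 : Pr mu [set om | Q3 (Z om)] <= gam.
  by rewrite (Pr_read_pred mu st L i (fun a => Lam < p L a)).
have P4 : Pr mu [set om | Q4 (Z om)] <= C * indep_mass l (fun xy => ~~ D xy).
  rewrite (Pr_sum mu Q4 mZ) (partition_big fst (fun xy => ~~ D xy)) /=; last first.
    by move=> z; rewrite /Q4 -!andbA => /andP[].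
  rewrite mulr_sumr; apply: ler_sum => -[x y] nD /=.
  rewrite -(Pr_sum mu (fun z => Q4 z && (z.1 == (x, y))) mZ).
  set S := [set om | _].
  (* All paths with the reads [x] and [y] agree on the window, so one sample path [om0] of the event
     fixes the word seen there. *)
  have [->|/set0P[om0 /andP[/= Q4om0 /eqP [r1 r2]]]] := eqVneq S set0.
    by rewrite Pr_set0 !mulr_ge0 ?wpmf_ge0.
  apply: (@le_trans _ _ (p L (read L om0 i))).
    rewrite -(Pr_read mu L i)//; apply: Pr_le.
    - exact: (observable_set (fun z => Q4 z && (z.1 == (x, y))) mZ).
    - exact: observable_read.
    - move=> om /andP[_ /= /eqP[s1 s2]]; apply/ffunP => j; rewrite !ffunE.
      have j1 : i <= i + j%:Z by rewrite lerDl.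
      have j2 : i + j%:Z < i + L%:Z by rewrite ltrD2l ltz_nat ltn_ord.
      have [[z1 z2]|[z1 z2]] := cover _ j1 j2.
      + exact: (read_eq_at (etrans s1 (esym r1)) z1 z2).
      + exact: (read_eq_at (etrans s2 (esym r2)) z1 z2).
  move: Q4om0; rewrite /Q4 /Q1 /Q2 /Q3 /= r1 r2 -!leNgt => /andP[/andP[/andP[_ t1] t2] t3].
  apply: (le_trans t3); apply: (le_trans HLam); rewrite ler_wpM2l// expr2.
  exact: ler_pM.
have : 1 <= Pr mu [set om | Q0 (Z om) || (Q1 (Z om) || (Q2 (Z om) || (Q3 (Z om) || Q4 (Z om))))].
  rewrite -(Pr_setT mu); apply: Pr_le => //.
    exact: (observable_set (fun z => Q0 z || (Q1 z || (Q2 z || (Q3 z || Q4 z)))) mZ).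
  move=> om _ /=; rewrite /Q4 /Q0; case: (D _) => //=.
  by case: (Q1 _) => //=; case: (Q2 _) => //=; case: (Q3 _).
have := Pr_orb Q0 (fun z => Q1 z || (Q2 z || (Q3 z || Q4 z))) mZ.
have := Pr_orb Q1 (fun z => Q2 z || (Q3 z || Q4 z)) mZ.
have := Pr_orb Q2 (fun z => Q3 z || Q4 z) mZ.
have := Pr_orb Q3 Q4 mZ.
move: P1 P2 P3 P4; rewrite /Q0 /=; lra.
Qed.

(* Mixing is applied pointwise, hence the need to beat the least positive probability. *)
Lemma distant_pair_bound (l s : nat) (i1 i2 : int)
    (D : pred ({ffun 'I_l -> X} * {ffun 'I_l -> X})) :
  i1 + l%:Z - 1 + s%:Z <= i2 ->
  (forall b, 0 < p l b -> mixing_coeff mu s <= p l b / 2) ->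
  indep_mass l D / 2 <= Pr mu [set om | D (read l om i1, read l om i2)].
Proof.
move=> Hs Hd.
rewrite (Pr_sum mu D (observable_pair (observable_read l i1) (observable_read l i2))).
rewrite mulr_suml; apply: ler_sum => -[x y] _ /=.
have x_ge0 := wpmf_ge0 mu l x.
have [y0|] := ltP 0 (p l y); last first.
  move=> y0; have -> : p l y = 0 by apply/eqP; rewrite eq_le y0 wpmf_ge0.
  by rewrite mulr0 mul0r Pr_ge0.
have := mixing_reads mu st s l l i1 i2 x y Hs.
rewrite ler_norml => /andP[+ _].
have := ler_wpM2r x_ge0 (Hd y y0); lra.
Qed.

End Pairs.

(** * Entropy rates in natural logarithms *)

Section Rates.
Context {R : realType} {X : finType} {x0 : X} (mu : probability (Omega X x0) R).
Hypothesis st : stationary mu.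
Hypothesis cardX : (1 < #|X|)%N.

Local Notation p := (wpmf mu).

Lemma ln_card_gt0 : 0 < ln (#|X|%:R) :> R.
Proof. by rewrite ln_gt0// ltr1n. Qed.

Lemma window_pmfE t w : window_pmf mu t w = p (2 * t).+1 w.
Proof.
rewrite -(Pr_read mu _ (- t%:Z))//; congr (Pr mu _); apply/seteqP; split => om /=.
  by move=> H; apply/ffunP => j; rewrite ffunE addrC H.
by move=> <- j; rewrite ffunE addrC.
Qed.

Lemma shannon_windowE t : shannon (X := X) _ (window_pmf mu t) = entropy mu (2 * t).+1 / ln (#|X|%:R).
Proof.
rewrite /shannon /entropy mulr_suml big_mkcond /=; apply: eq_bigr => w _.
rewrite window_pmfE; case: ifPn => [_|]; first by rewrite /logX mulrN mulrA mulNr.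
rewrite -leNgt => p0; have -> : p (2 * t).+1 w = 0 by apply/eqP; rewrite eq_le p0 wpmf_ge0.
by rewrite !mul0r.
Qed.

Lemma entropy_rate_of_shannon h1 : shannon_rate mu h1 ->
  forall e, 0 < e -> exists t0 : nat, forall t, (t0 <= t)%N ->
  `| entropy mu (2 * t).+1 - (2 * t).+1%:R * (h1 * ln (#|X|%:R)) | <= (2 * t).+1%:R * e.
Proof.
have K0 := ln_card_gt0; set K := ln _ in K0 *.
move=> /cvgrPdist_le H e e0; have [|t0 _ Ht0] := H (e / K); first by rewrite divr_gt0.
exists t0 => t /Ht0 /=; rewrite shannon_windowE -/K.
have L0 : 0 < (2 * t).+1%:R :> R by [].
set L := (2 * t).+1%:R in L0 *; set E := entropy _ _.
have -> : h1 - E / K / L = - (E - L * (h1 * K)) / (L * K) by field; rewrite !gt_eqF.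
by rewrite normrM normrN normfV [`|L * K|]gtr0_norm ?mulr_gt0// ler_pdivrMr ?mulr_gt0// (_ : e / K * _ = L * e)//;
  field; rewrite gt_eqF.
Qed.

Lemma shannon_rate_ge0 h1 : shannon_rate mu h1 -> 0 <= h1.
Proof.
move=> H; apply: (cvgr_to_ge H); near=> t.
rewrite divr_ge0//; apply: sumr_ge0 => w; rewrite window_pmfE => w0.
rewrite oppr_ge0 pmulr_rle0// pmulr_lle0 ?invr_gt0 ?ln_card_gt0//.
by rewrite ln_le0// wpmf_le1.
Unshelve. all: by end_near. Qed.

Lemma H_minf_window_ge t w : 0 < p (2 * t).+1 w ->
  - ln (p (2 * t).+1 w) <= ln (#|X|%:R) * H_minf (X := X) _ (window_pmf mu t).
Proof.
move=> pw; rewrite /H_minf /logX mulrN mulrCA divff ?gt_eqF ?ln_card_gt0// mulr1 lerN2.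
rewrite -window_pmfE in pw *.
rewrite ler_ln ?posrE//; first exact: bigmin_le_cond.
by apply/bigmin_gtP; split.
Qed.

Lemma minf_rate_ge0 h : minf_rate mu h -> 0 <= h.
Proof.
move=> H; apply: (cvgr_to_ge H); near=> t.
rewrite divr_ge0// /H_minf /logX -mulNr divr_ge0 ?(ltW ln_card_gt0)// oppr_ge0 ln_le0//.
exact: bigmin_le_id.
Unshelve. all: by end_near. Qed.

(** A possible word of any length is a prefix of a possible window word with at most one more
    letter, and that word is no more probable. *)
Lemma support_rate h : minf_rate mu h -> forall e, 0 < e ->
  exists l0, forall l, (l0 <= l)%N -> forall a, 0 < p l a ->
  - ln (p l a) <= l%:R * (h * ln (#|X|%:R) + e).
Proof.
move=> Hh e e0; have h0 := minf_rate_ge0 h Hh.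
have K0 := ln_card_gt0; set K := ln _ in K0 *.
have e20 : 0 < e / 2 by rewrite divr_gt0.
move/cvgrPdist_le: Hh => H; have [|t0 _ Ht0] := H (e / 2 / K); first by rewrite divr_gt0.
exists (maxn (2 * t0).+1 (Num.truncn ((h * K + e / 2) / (e / 2))).+1) => l.
rewrite geq_max => /andP[Hl1 Hl2] a pa.
have {}Hl2 : h * K + e / 2 <= l%:R * (e / 2).
  rewrite -ler_pdivrMr//; apply: ltW; apply: lt_le_trans (truncnS_gt _) _.
  by rewrite ler_nat.
pose t := l./2.
have lN : (0 + l <= (2 * t).+1)%N by lia.
(* Otherwise [p l a], the total mass of its extensions, would vanish. *)
have [w ww pw] : exists2 w, subword (x0 := x0) l 0 w = a & 0 < p (2 * t).+1 w.
  apply/not_exists2P => Hn; move: pa; rewrite ltNge => /negP; apply.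
  have -> : p l a = \sum_b p l b * (b == a)%:R.
    by rewrite (bigD1 a)//= eqxx mulr1 big1 ?addr0// => b /negPf ->; rewrite mulr0.
  rewrite -(EX_subword mu st (2 * t).+1 l 0 (fun b => (b == a)%:R))//.
  apply: sumr_le0 => w _; have [/eqP wa|_] := boolP (_ == _); last by rewrite mulr0.
  by rewrite mulr1; case: (Hn w) => // /negP; rewrite -leNgt.
have paw : p (2 * t).+1 w <= p l a by rewrite -ww; exact: wpmf_le_subword.
apply: (@le_trans _ _ (- ln (p (2 * t).+1 w))); first by rewrite lerN2 ler_ln ?posrE.
apply: (le_trans (H_minf_window_ge t w pw)); rewrite -/K.
have := Ht0 t ltac:(rewrite /= /t; clear -Hl1; lia); rewrite /= ler_norml => /andP[+ _].
set HH := H_minf _ _.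
have L0 : 0 < (2 * t).+1%:R :> R by [].
move=> HL.
have {}HL : HH / (2 * t).+1%:R <= h + e / 2 / K by move: HL; set z := HH / _; set y := e / 2 / K; lra.
move: HL; rewrite ler_pdivrMr// => /(ler_wpM2l (ltW K0)).
have -> : K * ((h + e / 2 / K) * (2 * t).+1%:R) = (2 * t).+1%:R * (h * K + e / 2).
  by field; rewrite gt_eqF.
move=> /le_trans; apply.
have hK : 0 <= h * K + e / 2 by apply: addr_ge0; [apply: mulr_ge0 => //; exact: ltW|exact: ltW].
apply: (@le_trans _ _ ((l%:R + 1) * (h * K + e / 2))); last first.
  rewrite mulrDl mul1r (_ : l%:R * (h * K + e) = l%:R * (h * K + e / 2) + l%:R * (e / 2)); last by field.
  by rewrite lerD2l.
by rewrite ler_wpM2r// natr1 ler_nat; clear -lN; rewrite /t; lia.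
Qed.

Lemma powR_vanishes (kap : R) : 0 < kap -> forall e, 0 < e ->
  exists S : nat, forall s, (S <= s)%N -> s%:R `^ (- kap) <= e.
Proof.
move=> k0 e e0; exists (Num.truncn (expR (- ln e / kap))).+1 => s Hs.
have Hs' : expR (- ln e / kap) <= s%:R.
  by apply: ltW; apply: lt_le_trans (truncnS_gt _) _; rewrite ler_nat.
have s0 : 0 < s%:R :> R by apply: lt_le_trans Hs'; exact: expR_gt0.
rewrite /powR gt_eqF// -[leRHS]lnK ?posrE// ler_expR.
move: Hs'; rewrite -ler_ln ?posrE ?expR_gt0// expRK ler_pdivrMr//; lra.
Qed.

End Rates.

(** * Lower bound on the error of a detector *)

Lemma sumr_pred {R : pzRingType} n (P : pred 'I_n) (y : R) :
  \sum_(i < n | P i) y = (\sum_(i < n) P i)%N%:R * y.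
Proof.
rewrite natr_sum mulr_suml big_mkcond; apply: eq_bigr => i _.
by case: (P i); rewrite ?mul1r ?mul0r.
Qed.

Lemma count_ltn n c : (c <= n)%N -> (\sum_(i < n) (i < c) = c)%N.
Proof.
move=> cn; rewrite -[RHS](minn_idPr cn); elim: n {cn} => [|n IH]; first by rewrite big_ord0 min0n.
by rewrite big_ord_recr /= IH; case: (ltnP n c); lia.
Qed.

Lemma count_geq n c : (\sum_(i < n) (c <= i) = n - c)%N.
Proof.
elim: n => [|n IH]; first by rewrite big_ord0.
by rewrite big_ord_recr /= IH; case: (leqP c n); lia.
Qed.

Section Counting.
Context {R : realType} {X : finType} {x0 : X} (mu : probability (Omega X x0) R).

(** Consequently every offset of absolute value below [l] lies in the support of [I(2) - I(1)]. *)
Lemma lo_bounds n l (i : int) : (2 * l <= n)%N -> 1 <= i -> i <= n%:Z ->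
  l%:Z - n%:Z <= lo n l i /\ lo n l i <= 1 - l%:Z.
Proof. by rewrite /lo => *; do 2?case: ifP; lia. Qed.

(** For starts in the first quarter, the upper half of the values of [k] therefore puts the second
    read at least [n / 4] further right. *)
Lemma lo_ge n l (i : int) : (4 * l <= n)%N -> 1 <= i -> 4 * i <= n%:Z ->
  - i <= lo n l i \/ 1 - l%:Z <= lo n l i.
Proof. by rewrite /lo => *; do 2?case: ifP; lia. Qed.

Definition nodetect l (f : detector (X := X) l) : pred ({ffun 'I_l -> X} * {ffun 'I_l -> X}) :=
  fun xy => Defs.tval l (f xy.1 xy.2) == 0.

(** Two disjoint families of positions are kept: for each start, the [2 tau] offsets with overlap
    [1] to [tau] in either direction, and [n / 4] times [n / 2] pairs too distant to overlap. The
    bound [tau < l] keeps the offsets nonzero, hence the two directions distinct. *)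
Lemma perror_ge (n l tau : nat) (f : detector (X := X) l) (v y : R) :
  (tau < l)%N -> (l <= n %/ 4)%N -> 0 <= y ->
  (forall (i1 i2 : int) (t : nat), (0 < t <= tau)%N ->
     i2 - i1 = l%:Z - t%:Z \/ i1 - i2 = l%:Z - t%:Z ->
     v <= Pr mu [set om : Omega X x0 | nodetect l f (read l om i1, read l om i2)]) ->
  (forall i1 i2 : int, (n %/ 4)%N%:Z <= i2 - i1 ->
     y <= Pr mu [set om : Omega X x0 | ~~ nodetect l f (read l om i1, read l om i2)]) ->
  (n%:R ^+ 2)^-1 * (n%:R * ((2 * tau)%:R * v) + (n %/ 4)%:R * ((n %/ 2)%:R * y))
  <= perror mu n l f.
Proof.
move=> tl ln y0 Hnear Hfar.
pose e (a k : 'I_n) := Pr mu [set om : Omega X x0 |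
  Defs.tval l (f (read l om (a%:Z + 1)) (read l om (a%:Z + 1 + lo n l (a%:Z + 1) + k%:Z)))
    <> overlap l (a%:Z + 1) (a%:Z + 1 + lo n l (a%:Z + 1) + k%:Z)].
have -> : perror mu n l f = (n%:R ^+ 2)^-1 * \sum_(a < n) \sum_(k < n) e a k.
  by rewrite /perror mulr_sumr; apply: eq_bigr => a _; rewrite mulr_sumr.
rewrite ler_wpM2l ?invr_ge0 ?sqr_ge0//.
pose far (a k : 'I_n) := (a < n %/ 4)%N && (n - n %/ 2 <= k)%N.
apply: (@le_trans _ _ (\sum_(a < n) ((2 * tau)%:R * v +
   (if (a < n %/ 4)%N then (n %/ 2)%:R * y else 0)))).
  rewrite big_split /= sumr_const card_ord mulr_natl lerD2l -big_mkcond sumr_pred.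
  by rewrite count_ltn// leq_div.
apply: ler_sum => a _.
have an := ltn_ord a.
rewrite (bigID (far a)) /= addrC; apply: lerD; last first.
  rewrite /far; case: (ltnP a (n %/ 4)) => /= Ha; last by rewrite big_pred0.
  apply: (@le_trans _ _ (\sum_(k < n | (n - n %/ 2 <= k)%N) y)).
    by rewrite sumr_pred count_geq subKn// leq_div.
  apply: ler_sum => k Hk.
  have [lo1 lo2] := lo_bounds n l (a%:Z + 1) ltac:(lia) ltac:(lia) ltac:(lia).
  have lo3 := lo_ge n l (a%:Z + 1) ltac:(lia) ltac:(lia) ltac:(lia).
  have kn := ltn_ord k.
  have D : (n %/ 4)%N%:Z <= a%:Z + 1 + lo n l (a%:Z + 1) + k%:Z - (a%:Z + 1) by lia.
  apply: (le_trans (Hfar _ _ D)); rewrite le_eqVlt; apply/orP; left; apply/eqP.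
  rewrite /e; congr (Pr mu _).
  have -> : overlap l (a%:Z + 1) (a%:Z + 1 + lo n l (a%:Z + 1) + k%:Z) = 0.
    by rewrite /overlap; case: ifP; lia.
  by apply/seteqP; split => om /= /eqP.
(* The index [k] for which the reads share [t + 1] letters; the boolean tells which read comes
   first. *)
pose kk (bt : bool * 'I_tau) : int :=
  (if bt.1 then l%:Z - (bt.2%:Z + 1) else (bt.2%:Z + 1) - l%:Z) - lo n l (a%:Z + 1).
have [lo1 lo2] := lo_bounds n l (a%:Z + 1) ltac:(lia) ltac:(lia) ltac:(lia).
have kk_bd bt : 0 <= kk bt /\ kk bt < n%:Z.
  by case: bt => b t; have := ltn_ord t; rewrite /kk; case: b => /=; lia.
(* The default [a] is never taken, as [kk] lies in range. *)
pose phi bt : 'I_n := insubd a (absz (kk bt)).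
have phiE bt : (phi bt)%:Z = kk bt.
  have [H1 H2] := kk_bd bt; rewrite val_insubd; case: ifPn; lia.
have phi_inj : injective phi.
  move=> [b t] [b' t'] E; have := congr1 (fun i : 'I_n => i%:Z) E; rewrite /= !phiE /kk.
  have := ltn_ord t; have := ltn_ord t'.
  case: b {E}; case: b' => /= *; try lia; by congr (_, _); apply/val_inj; rewrite /=; lia.
apply: (@le_trans _ _ (\sum_(k in imset phi (mem predT)) e a k)); last first.
  rewrite [leRHS]big_mkcond [leLHS]big_mkcond; apply: ler_sum => k _.
  case: ifPn => [/imsetP[[b t] _ ->]|_]; last by case: ifP => // _; exact: Pr_ge0.
  rewrite ifT//; apply/negP => /andP[Ha Hk].
  have lo3 := lo_ge n l (a%:Z + 1) ltac:(lia) ltac:(lia) ltac:(lia).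
  have := phiE (b, t); rewrite /kk; have := ltn_ord t.
  by case: b Hk => /=; lia.
rewrite big_imset /=; last by move=> ? ? _ _; exact: phi_inj.
apply: (@le_trans _ _ (\sum_(bt : bool * 'I_tau) v)).
  by rewrite sumr_const card_prod card_bool card_ord mulr_natl.
apply: ler_sum => -[b t] _.
have tt := ltn_ord t; have := phiE (b, t); rewrite /kk /= => Hphi.
have H2 : a%:Z + 1 + lo n l (a%:Z + 1) + (phi (b, t))%:Z - (a%:Z + 1) =
  (if b then l%:Z - (t%:Z + 1) else (t%:Z + 1) - l%:Z).
  by rewrite Hphi; case: (b); lia.
apply: le_trans (Hnear (a%:Z + 1) (a%:Z + 1 + lo n l (a%:Z + 1) + (phi (b, t))%:Z) t.+1 _ _) _.
- by [].
- by case: b H2 {Hphi} => H2; [left|right]; lia.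
rewrite /e; have mZ := observable_pair (observable_read (x0 := x0) l (a%:Z + 1))
  (observable_read l (a%:Z + 1 + lo n l (a%:Z + 1) + (phi (b, t))%:Z)).
set o := overlap _ _ _.
have o0 : o != 0.
  apply/eqP; rewrite /o /overlap; move: H2; set i2 := _ + (phi _)%:Z; case: (b); case: ifP; lia.
apply: Pr_le.
- exact: (observable_set (nodetect l f) mZ).
- have -> : [set om : Omega X x0 | Defs.tval l (f (read l om (a%:Z + 1))
      (read l om (a%:Z + 1 + lo n l (a%:Z + 1) + (phi (b, t))%:Z))) <> o] =
    [set om : Omega X x0 | (fun xy => Defs.tval l (f xy.1 xy.2) != o)
      (read l om (a%:Z + 1), read l om (a%:Z + 1 + lo n l (a%:Z + 1) + (phi (b, t))%:Z))].
    by apply/seteqP; split => om /= /eqP.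
  exact: (observable_set (fun xy => Defs.tval l (f xy.1 xy.2) != o) mZ).
- by move=> om; rewrite /nodetect /= => /eqP ->; apply/eqP; rewrite eq_sym.
Qed.

Lemma perror_ge0 n l (f : detector (X := X) l) : 0 <= perror mu n l f.
Proof.
apply: sumr_ge0 => a _; apply: sumr_ge0 => k _.
by rewrite mulr_ge0 ?Pr_ge0// invr_ge0 sqr_ge0.
Qed.

Lemma perror_opt_ge beta n (y : R) : (0 < readlen (X := X) beta n)%N ->
  (forall f, y <= perror mu n (readlen (X := X) beta n) f) -> y <= perror_opt mu beta n.
Proof.
move=> l0 H; apply: lb_le_inf; last by move=> _ [f _ <-].
(* A constant detector shows that the infimum runs over a nonempty set. *)
have l2 : (0 < 2 * readlen (R := R) (X := X) beta n)%N by lia.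
by eexists; exists (fun _ _ => Ordinal l2).
Qed.

(* For [readlen beta n = 0] there is no detector, and the infimum of the empty set is 0. *)
Lemma perror_opt_ge0 beta n : 0 <= perror_opt mu beta n.
Proof.
rewrite /perror_opt; set S := (X in inf X).
have [->|/set0P S0] := eqVneq S set0; first by rewrite inf0.
by apply: lb_le_inf => // _ [f _ <-]; exact: perror_ge0.
Qed.

End Counting.

(** * Asymptotics *)

(** [expR (b * x)] is the square of [expR (b * x / 2)], which is at least [b * x / 2]. *)
Lemma linear_le_expR {R : realType} (A b : R) : 0 < b ->
  exists T, forall x, T <= x -> A * x <= expR (b * x).
Proof.
move=> b0; exists (Num.max 0 (4 * A / b ^+ 2)) => x; rewrite ge_max => /andP[x0].
rewrite ler_pdivrMr ?exprn_gt0// => HA.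
have bx : 0 <= b * x / 2 by rewrite divr_ge0// mulr_ge0// ltW.
rewrite (_ : b * x = b * x / 2 + b * x / 2) ?expRD; last by field.
have H : b * x / 2 <= expR (b * x / 2) by have := expR_ge1Dx (b * x / 2); lra.
apply: le_trans (ler_pM bx bx H H).
have : A * x <= x * b ^+ 2 / 4 * x by rewrite ler_wpM2r//; lra.
by move=> /le_trans; apply; rewrite le_eqVlt; apply/orP; left; apply/eqP; field.
Qed.

Section Main.
Context {R : realType} {X : finType} {x0 : X} (mu : probability (Omega X x0) R).
Variables (beta eta hm h1 : R).
Hypotheses (cardX : (1 < #|X|)%N) (beta0 : 0 < beta) (st : stationary mu).
Hypotheses (rate_m : minf_rate mu hm) (rate_1 : shannon_rate mu h1) (eta0 : 0 < eta).
Hypothesis mixing : forall s : nat, (0 < s)%N ->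
     mixing_coeff mu s <= s%:R `^ (- (beta * hm + eta)).

Local Notation K := (ln (#|X|%:R : R)).
Local Notation p := (wpmf mu).

Let K0 : 0 < K := ln_card_gt0 cardX.
Let hm0 : 0 <= hm := minf_rate_ge0 mu cardX hm rate_m.
Let h10 : 0 <= h1 := shannon_rate_ge0 mu st cardX h1 rate_1.

Let kap0 : 0 < beta * hm + eta.
Proof. by rewrite ltr_wpDl// mulr_ge0// ltW. Qed.

Let mix0 (e : R) : 0 < e -> exists S : nat, forall s, (S <= s)%N -> mixing_coeff mu s <= e.
Proof.
move=> e0; have [S HS] := powR_vanishes _ kap0 e e0.
exists S.+1 => s Hs; apply: le_trans (mixing s _) (HS s _); lia.
Qed.

Lemma readlen_bounds n : 0 <= ln (n%:R : R) ->
  let l := (readlen (X := X) beta n)%:R in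
  beta * ln n%:R / K - 2^-1 <= l /\ l <= beta * ln n%:R / K + 2^-1.
Proof.
move=> n0 /=; rewrite /readlen /logX.
pose y : R := beta * (ln n%:R / K) + 2^-1.
have y0 : 0 <= y.
  by apply: addr_ge0 => //; apply: mulr_ge0; [exact: ltW|apply: divr_ge0 => //; exact: ltW].
have := truncn_itv y0 => /andP[]; rewrite -/y -natr1 /y.
set z := _ / K in y y0 *; rewrite -mulrA -/z; lra.
Qed.

(** A possible read has probability at least about [n ^ (- (beta hm + eta / 2))], while a gap of
    order [n] gives mixing of order [n ^ (- (beta hm + eta))]. *)
Lemma mixing_coeff_le_half_wpmf : exists A : R, forall n l s : nat, A <= ln n%:R -> (0 < n)%N ->
  l%:R <= beta * ln n%:R / K + 2^-1 -> A <= l%:R -> (n <= 8 * s)%N ->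
  forall b, 0 < p l b -> mixing_coeff mu s <= p l b / 2.
Proof.
have K_n0 : K != 0 by rewrite gt_eqF.
have b_n0 : beta != 0 by rewrite gt_eqF.
pose e := eta * K / (2 * beta).
have e0 : 0 < e by rewrite divr_gt0 ?mulr_gt0.
have [l0 H] := support_rate mu st cardX hm rate_m e e0.
(* The spare factor [n ^ (eta / 2)] absorbs the 8 in the gap, the rounding of the read length and
   the factor 2. *)
pose A := ((beta * hm + eta) * ln 8 + (hm * K + e) / 2 + ln 2) * 2 / eta.
exists (Num.max l0%:R A) => n l s; rewrite !ge_max => /andP[_ nA] n0 l_le /andP[ll _] ns b pb.
have s0 : (0 < s)%N by clear -n0 ns; lia.
have {}H := H l ltac:(by rewrite -(ler_nat R)) b pb.
apply: (le_trans (mixing s s0)).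
have sR0 : 0 < s%:R :> R by rewrite ltr0n.
rewrite /powR gt_eqF//.
have -> : p l b / 2 = expR (ln (p l b) - ln 2) by rewrite expRD expRN !lnK ?posrE.
rewrite ler_expR.
have lns : ln n%:R <= ln 8 + ln s%:R :> R.
  have <- : ln (8 * s%:R) = ln 8 + ln s%:R :> R by apply: lnM; rewrite posrE.
  by rewrite ler_ln ?posrE ?mulr_gt0 ?ltr0n// -natrM ler_nat.
have {}nA : (beta * hm + eta) * ln 8 + (hm * K + e) / 2 + ln 2 <= eta / 2 * ln n%:R.
  by move: nA; rewrite /A ler_pdivrMr//; lra.
have hKe : 0 <= hm * K + e.
  by apply: addr_ge0; [apply: mulr_ge0 => //|]; exact: ltW.
have {}l_le := ler_wpM2r hKe l_le.
have E : (beta * ln n%:R / K + 2^-1) * (hm * K + e)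
  = (beta * hm + eta / 2) * ln n%:R + (hm * K + e) / 2.
  by rewrite /e; field; rewrite K_n0 b_n0.
rewrite E in l_le.
have := ler_wpM2l (ltW kap0) lns.
lra.
Qed.

(** Stands for the minimum of [beta] and [1 / h1]; the product form [c * h1 <= 1] includes
    [h1 = 0]. *)
Variable c : R.
Hypotheses (c0 : 0 < c) (c_beta : c <= beta) (c_h1 : c * h1 <= 1).

(** Whatever the mass [m] that the detector assigns to nonzero answers on independent reads, the
    false alarms it causes outweigh the missed-overlap error it saves, so [m] drops out. *)
Lemma perror_asymptotic (rho : R) : 0 < rho -> rho <= 1 ->
  exists A : R, forall n : nat, A <= ln n%:R ->
  (0 < readlen (X := X) beta n)%N /\
  forall f, 2 * (1 - rho) * c * (ln n%:R / K) / n%:R <=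
    perror mu n (readlen (X := X) beta n) f.
Proof.
move=> rho0 rho1.
have K_n0 : K != 0 by rewrite gt_eqF.
have b_n0 : beta != 0 by rewrite gt_eqF.
pose del := rho / 4.
have del0 : 0 < del by rewrite divr_gt0.
(* Makes [4 l eps <= (del / 2) ln n], the total typicality slack in the likelihood ratio. *)
pose eps := del * K / (16 * beta).
have eps0 : 0 < eps by rewrite divr_gt0 ?mulr_gt0.
have gam0 : 0 < rho / 12 by rewrite divr_gt0.
have hn0 : 0 <= h1 * K by rewrite mulr_ge0// ltW.
have ent := entropy_rate_of_shannon mu st cardX h1 rate_1.
have [l1 Hlow] := typical_lower mu st mix0 (h1 * K) hn0 ent eps (rho / 12) eps0 gam0.
have supp := support_rate mu st cardX hm rate_m 1 ltr01.
have [l2 Hup] := typical_upper mu st mix0 (h1 * K) hn0 ent _ supp eps (rho / 12) eps0 gam0.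
have [A3 Hfar] := mixing_coeff_le_half_wpmf.
have [T HT] := linear_le_expR (256 * beta / K) (del / 2) ltac:(by rewrite divr_gt0).
pose A4 := (l1%:R + l2%:R + Num.max 0 A3 + 2) * K / beta.
(* [A3] is for mixing, [A4] makes [l] long enough for typicality, [T] gives
   [128 l <= n ^ (del / 2)], and the last term makes [del c log n >= 1], so rounding [tau] down is
   harmless. *)
exists (Num.max 1 (Num.max A3 (Num.max A4 (Num.max T (K / (del * c)))))) => n.
set x := ln n%:R.
rewrite !ge_max => /and5P[x1 xA3 xA4 xT xc].
have x_ge0 : 0 <= x by lra.
have n0 : (0 < n)%N by rewrite lt0n; apply/negP => /eqP n0; move: x1; rewrite /x n0 ln0//; lra.
have nR : 0 < n%:R :> R by rewrite ltr0n.
have nE : n%:R = expR x by rewrite /x lnK ?posrE.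
set l := readlen _ _.
have [lge lle] : beta * x / K - 2^-1 <= l%:R /\ l%:R <= beta * x / K + 2^-1.
  by apply: readlen_bounds.
clearbody l.
set bx := beta * x / K in lge lle.
have bxA : l1%:R + l2%:R + Num.max 0 A3 + 2 <= bx.
  by move: xA4; rewrite /A4 ler_pdivrMr// /bx ler_pdivlMr//; lra.
have m0 : 0 <= Num.max 0 A3 by rewrite le_max lexx.
have mA : A3 <= Num.max 0 A3 by rewrite le_max lexx orbT.
have n1 : 0 <= l1%:R :> R by []. have n2 : 0 <= l2%:R :> R by [].
have ll1 : (l1 <= l)%N by rewrite -(ler_nat R); lra.
have ll2 : (l2 <= l)%N by rewrite -(ler_nat R); lra.
have l_gt0 : (0 < l)%N by rewrite -(ltr_nat R); lra.
split=> // f.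
have l2bx : l%:R <= 2 * bx by lra.
have HTx := HT x xT.
have l128 : 128 * l%:R <= expR (del / 2 * x).
  apply: le_trans HTx; have -> : 256 * beta / K * x = 128 * (2 * bx) by rewrite /bx; field.
  by rewrite ler_pM2l.
have l128n : (128 * l <= n)%N.
  rewrite -(ler_nat R) natrM nE; apply: (le_trans l128); rewrite ler_expR.
  by rewrite ler_piMl//; rewrite /del; lra.
have cx : 1 <= del * (c * (x / K)).
  move: xc; rewrite ler_pdivrMr ?mulr_gt0// => xc.
  by rewrite !mulrA ler_pdivlMr//; lra.
have xK0 : 0 <= x / K by rewrite divr_ge0// ltW.
have cxb : c * (x / K) <= bx by rewrite /bx -mulrA ler_wpM2r.
pose y := (1 - del) * c * (x / K).
have y0 : 0 <= y.
  by apply: mulr_ge0 => //; apply: mulr_ge0; [rewrite /del; lra|exact: ltW].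
pose tau := Num.truncn y.
have [tau1 tau2] : tau%:R <= y /\ y < tau%:R + 1.
  by have /andP[] := truncn_itv y0; rewrite -natr1.
have tau_l : (tau < l)%N.
  rewrite -(ltr_nat R); apply: (le_lt_trans tau1).
  rewrite /y -mulrA mulrBl mul1r; lra.
have l4 : (l <= n %/ 4)%N by clear -l128n; lia.
(* The gap left between two reads of length [l] whose starts are [n / 4] apart. *)
have l8 : (n <= 8 * (n %/ 4 - l).+1)%N by clear -l128n; lia.
have n_large : (128 <= n)%N by clear -l128n l_gt0; lia.
pose m := indep_mass mu l (fun xy => ~~ nodetect l f xy).
have m_ge0 : 0 <= m by exact: indep_mass_ge0.
pose C := expR ((1 - del / 2) * x).
pose v := 1 - 3 * (rho / 12) - C * m.
have := perror_ge mu n l tau f v (m / 2) tau_l l4 (divr_ge0 m_ge0 (ler0n R 2)).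
have near : forall (i1 i2 : int) (t : nat), (0 < t <= tau)%N ->
     i2 - i1 = l%:Z - t%:Z \/ i1 - i2 = l%:Z - t%:Z ->
     v <= Pr mu [set om : Omega X x0 | nodetect l f (read l om i1, read l om i2)].
  move=> i1 i2 t /andP[t0 tt] Hi.
  have t2l : (t <= 2 * l)%N by clear -tt tau_l; lia.
  have tL : (l <= 2 * l - t)%N by clear -tt tau_l; lia.
  (* The window is the union of the reads: it starts at the left one and has [2 l - t] letters. *)
  apply: (overlapping_pair_bound mu st l (2 * l - t) i1 i2 (if i1 <= i2 then i1 else i2)
     (nodetect l f) (expR (- (l%:R * (h1 * K + eps))))
     (expR (- ((2 * l - t)%:R * (h1 * K - eps)))) C (rho / 12)).
  - by clear -Hi tt tau_l; move=> z; case: ifP; lia.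
  - exact: expR_ge0.
  - exact: expR_ge0.
  (* The exponent to control is [t h1 K] plus slack: the first is at most [(1 - del) ln n] as
     [c * h1 <= 1], the slack at most [(del / 2) ln n]. *)
  - rewrite /C expr2 -!expRD ler_expR natrB//.
    rewrite natrM.
    have tR : t%:R <= y by apply: le_trans tau1; rewrite ler_nat.
    have th : t%:R * (h1 * K) <= (1 - del) * x.
      apply: (le_trans (ler_wpM2r hn0 tR)).
      have -> : y * (h1 * K) = (1 - del) * x * (c * h1) by rewrite /y; field.
      rewrite -[leRHS]mulr1 ler_wpM2l// mulr_ge0//; rewrite /del; lra.
    have le4 : 4 * l%:R * eps <= del / 2 * x.
      have -> : del / 2 * x = 4 * (2 * bx) * eps by rewrite /bx /eps; field; rewrite K_n0 b_n0.
      by rewrite ler_pM2r// ler_pM2l.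
    have te : 0 <= t%:R * eps by rewrite mulr_ge0// ltW.
    lra.
  - exact: Hlow.
  - by apply: Hup; exact: leq_trans tL.
have far : forall i1 i2 : int, (n %/ 4)%N%:Z <= i2 - i1 ->
     m / 2 <= Pr mu [set om : Omega X x0 | ~~ nodetect l f (read l om i1, read l om i2)].
  move=> i1 i2 H12.
  apply: (distant_pair_bound mu st l (n %/ 4 - l).+1 i1 i2 (fun xy => ~~ nodetect l f xy)).
    by clear -H12 l4; lia.
  by apply: (Hfar n l) => //; lra.
move=> /(_ near far); apply: le_trans.
have q : n%:R ^+ 2 / 64 * m <= (n %/ 4)%:R * ((n %/ 2)%:R * (m / 2)).
  have q4 : n%:R / 8 <= (n %/ 4)%:R :> R.
    by rewrite ler_pdivrMr// -natrM ler_nat; clear -n_large; lia.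
  have q2 : n%:R / 4 <= (n %/ 2)%:R :> R.
    by rewrite ler_pdivrMr// -natrM ler_nat; clear -n_large; lia.
  have := ler_pM (divr_ge0 (ltW nR) (ler0n R 8)) (divr_ge0 (ltW nR) (ler0n R 4)) q4 q2.
  have m2 : 0 <= m / 2 by rewrite divr_ge0.
  move=> /(ler_wpM2r m2); rewrite expr2; lra.
have tC : 128 * tau%:R * C <= n%:R.
  rewrite nE (_ : x = del / 2 * x + (1 - del / 2) * x) ?expRD -/C; last by field.
  rewrite ler_pM2r ?expR_gt0//; apply: le_trans l128; rewrite ler_pM2l// ler_nat.
  exact: ltnW.
(* The false alarms compensate the whole deficit [C * m] in [v]. *)
have tCm : n%:R * (2 * tau%:R * C * m) <= n%:R ^+ 2 / 64 * m.
  have nm : 0 <= n%:R * m by rewrite mulr_ge0// ltW.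
  have := ler_wpM2l nm tC; rewrite expr2; lra.
(* Here [(1 - rho / 2) (1 - rho / 4) >= 1 - rho]; the three typicality failures cost [rho / 4] in
   all. *)
have fin : (1 - rho) * c * (x / K) <= tau%:R * (1 - 3 * (rho / 12)).
  have r4 : 0 <= 1 - 3 * (rho / 12) by lra.
  have t1 : (1 - 2 * del) * (c * (x / K)) <= tau%:R by move: tau2 cx; rewrite /y; lra.
  apply: le_trans (ler_wpM2r r4 t1).
  have cx0 : 0 <= c * (x / K) by rewrite mulr_ge0// ltW.
  rewrite -mulrA [leRHS]mulrAC ler_wpM2r// /del; nra.
rewrite mulrC -[n%:R^-1 * _]/(_) .
apply: (@le_trans _ _ ((n%:R ^+ 2)^-1 * (n%:R * (2 * tau%:R * (1 - 3 * (rho / 12)))))); last first.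
  rewrite ler_wpM2l ?invr_ge0 ?sqr_ge0// natrM /v; lra.
rewrite (_ : (n%:R ^+ 2)^-1 * (n%:R * (2 * tau%:R * (1 - 3 * (rho / 12)))) =
  n%:R^-1 * (2 * (tau%:R * (1 - 3 * (rho / 12))))); last by field; rewrite gt_eqF.
rewrite ler_wpM2l ?invr_ge0 ?(ltW nR)//; lra.
Qed.

End Main.

(** * From fixed [rho] to a vanishing sequence *)

Theorem mainTheorem2 (R : realType) (X : finType) (x0 : X)
  (mu : probability (Omega X x0) R) (beta eta h_minf h1 : R) :
  (1 < #|X|)%N -> 0 < beta ->
  stationary mu -> ergodic mu ->
  minf_rate mu h_minf -> shannon_rate mu h1 ->
  0 < eta ->
  (forall s : nat, (0 < s)%N ->
     mixing_coeff mu s <= s%:R `^ (- (beta * h_minf + eta))) ->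
  exists eps : nat -> R, eps @ \oo --> 0 /\
    forall n : nat,
      perror_opt mu beta n >=
      2 * (1 + eps n) * (if h1 == 0 then beta else Num.min beta h1^-1)
        * logX X n%:R / n%:R.
Proof.
move=> cardX beta0 st _ rate_m rate_1 eta0 mixing.
have h10 := shannon_rate_ge0 mu st cardX h1 rate_1.
have K0 := @ln_card_gt0 R X cardX.
set c := (if h1 == 0 then beta else Num.min beta h1^-1).
have [c0 c_beta c_h1] : [/\ 0 < c, c <= beta & c * h1 <= 1].
  rewrite /c; case: eqVneq => [->|h1n0]; first by rewrite mulr0.
  have {}h10 : 0 < h1 by rewrite lt0r h1n0.
  split; [by rewrite lt_min beta0 invr_gt0|by rewrite ge_min lexx|].
  by rewrite -ler_pdivlMr// div1r ge_min lexx orbT.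
pose ratio n := perror_opt mu beta n / (2 * c * logX X n%:R / n%:R).
(* Capping at 0 keeps the inequality for every [n] and leaves only an asymptotic lower bound on
   [ratio] to prove. *)
exists (fun n => Num.min 0 (ratio n - 1)); split; last first.
  (* For [n <= 1] the logarithm is 0, by convention at [n = 0], and the claim reduces to
     nonnegativity of the error. *)
  move=> n; have [n1|n2] := leqP n 1.
    have -> : logX X (n%:R : R) = 0.
      rewrite /logX; suff -> : ln (n%:R : R) = 0 by rewrite mul0r.
      by case: n n1 => [|[|//]] _; [apply: ln0|apply: ln1].
    by rewrite mulr0 mul0r perror_opt_ge0.
  have n0 : 0 < n%:R :> R by rewrite ltr0n; lia.
  have L0 : 0 < logX X (n%:R : R) by rewrite divr_gt0// ln_gt0// ltr1n.
  have B0 : 0 < 2 * c * logX X n%:R / n%:R by apply: divr_gt0 => //; apply: mulr_gt0 => //; apply: mulr_gt0.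
  have : Num.min 0 (ratio n - 1) <= ratio n - 1 by rewrite ge_min lexx orbT.
  set e := Num.min _ _ => He; have {}He : 1 + e <= ratio n by lra.
  move: He; rewrite /ratio ler_pdivlMr//; apply: le_trans.
  by rewrite le_eqVlt; apply/orP; left; apply/eqP; ring.
apply/cvgrPdist_le => rho' rho'0.
pose rho := Num.min rho' 1.
have rho0 : 0 < rho by rewrite lt_min rho'0 ltr01.
have rho1 : rho <= 1 by rewrite ge_min lexx orbT.
have [A HA] := perror_asymptotic mu beta eta h_minf h1 cardX beta0 st rate_m rate_1
  eta0 mixing c c0 c_beta c_h1 rho rho0 rho1.
exists (Num.truncn (expR A)).+2 => // n /= Hn.
have n1 : (1 < n)%N by lia.
have n0 : 0 < n%:R :> R by rewrite ltr0n; lia.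
have An : A <= ln n%:R.
  rewrite -[leLHS]expRK ler_ln ?posrE ?expR_gt0//; apply: ltW; apply: lt_le_trans (truncnS_gt _) _.
  by rewrite ler_nat ltnW.
have [l0 Hf] := HA n An.
have L0 : 0 < logX X (n%:R : R) by rewrite divr_gt0// ln_gt0// ltr1n.
have B0 : 0 < 2 * c * logX X n%:R / n%:R by apply: divr_gt0 => //; apply: mulr_gt0 => //; apply: mulr_gt0.
have : 1 - rho <= ratio n.
  rewrite /ratio ler_pdivlMr//; apply: (perror_opt_ge mu beta n _ l0) => f.
  apply: le_trans (Hf f).
  by rewrite le_eqVlt; apply/orP; left; apply/eqP; rewrite /logX; ring.
have : rho <= rho' by rewrite ge_min lexx.
rewrite sub0r normrN; set r := ratio n => H1 H2.
rewrite ler_norml; case: (leP 0 (r - 1)); lra.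
Qed.
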